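(* Let $f_0,f_1$ satisfy [A1]--[A5] and let the sequences $\{x^k\}_{k\in\mathbb{N}}$, $\{\tilde y^k\}_{k\in\mathbb{N}}$, $\{\hat y^k\}_{k\in\mathbb{N}}\subset\mathbb{R}^n$, $\{U^k\}_{k\in\mathbb{N}}\subset\mathbb{R}$ satisfy [S1]--[S3] (all conditions are listed in the context). Assume, in addition, that $\{x^k\}_{k\in\mathbb{N}}$ is bounded. Then $\{x^k\}_{k\in\mathbb{N}}$ converges to a stationary point of $F=f_0+f_1$, i.e. to a point $x^*\in\mathrm{dom}(F)$ with $0\in\partial F(x^* )$.
   Context: Let $F=f_0+f_1$ on $\mathbb{R}^n$. Assumptions on the functions: [A1] $f_1:\mathbb{R}^n\to\mathbb{R}\cup\{+\infty\}$ is proper, lower semicontinuous and convex. [A2] $f_0:\mathbb{R}^n\to\mathbb{R}$ is continuously differentiable on an open set $\Omega_0\supset\overline{\mathrm{dom}(f_1)}$. [A3] $\nabla f_0$ is $L_{f_0}$-Lipschitz continuous on $\mathrm{dom}(f_1)$. [A4] $F$ is bounded from below. [A5] The function $\mathcal{F}:\mathbb{R}^n\times\mathbb{R}\to\mathbb{R}\cup\{+\infty\}$, $\mathcal{F}(x,\rho)=F(x)+\frac12\rho^2$, is a KL function. Fixed parameters: $0<\alpha_{\min}\le\alpha_{\max}$, $\delta\in(0,1)$, $\omega\in(0,1)$. The sequences satisfy $x^0\in\mathrm{dom}(f_1)$ and $x^{k+1}=x^k+\eta_k(\tilde y^k-x^k)$ with $\eta_k\in(0,1]$ for all $k\ge 0$.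 Notation: $\mathrm{prox}_{\alpha f_1}(z)=\arg\min_y\{f_1(y)+\frac{1}{2\alpha}\|y-z\|^2\}$; $H_k(y)=\langle\nabla f_0(x^k),y-x^k\rangle+\frac{1}{2\alpha_k}\|y-x^k\|^2+f_1(y)-f_1(x^k)$; $\tilde\Delta_k=\langle\nabla f_0(x^k),\tilde y^k-x^k\rangle+\frac{1}{2\alpha_k}\|\tilde y^k-x^k\|^2+f_1(\tilde y^k)-U^k$; $\Phi(x,U)=f_0(x)+U$ for $(x,U)\in\mathbb{R}^n\times\mathbb{R}$; $d^k=\tilde y^k-x^k$. Conditions on the sequences: [S1] $U^0=f_1(x^0)$ and $U^{k+1}=\eta_kf_1(\tilde y^k)+(1-\eta_k)U^k$ for $k\ge0$. [S2] $\alpha_k\in[\alpha_{\min},\alpha_{\max}]$, $\hat y^k=\mathrm{prox}_{\alpha_kf_1}(x^k-\alpha_k\nabla f_0(x^k))$, and there is $\mu>0$ such that $H_k(\tilde y^k)-H_k(\hat y^k)\le-\frac{\mu}{2}\tilde\Delta_k$ for all $k$. [S3] For each $k$, $m_k$ is the smallest non-negative integer $m$ such that $$\min\{\Phi(x^k+\delta^{m}d^k,\ \delta^{m}f_1(\tilde y^k)+(1-\delta^{m})U^k),\ F(\tilde y^k)\}\le\Phi(x^k,U^k)+\omega\delta^{m}\tilde\Delta_k,$$ and $\eta_k=\delta^{m_k}$ if $\Phi(x^k+\delta^{m_k}d^k,\ \delta^{m_k}f_1(\tilde y^k)+(1-\delta^{m_k})U^k)<F(\tilde y^k)$, while $\eta_k=1$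 otherwise. Subdifferential: for $f:\mathbb{R}^N\to\mathbb{R}\cup\{+\infty\}$, $\partial f(x)$ is the limiting (Mordukhovich) subdifferential: $v\in\partial f(x)$ iff $f(x)$ is finite and there are $x_j\to x$ with $f(x_j)\to f(x)$ and $v_j\to v$ with $\liminf_{y\to x_j,\,y\ne x_j}\frac{f(y)-f(x_j)-\langle v_j,y-x_j\rangle}{\|y-x_j\|}\ge0$ for each $j$. KL function: a proper lower semicontinuous $f:\mathbb{R}^N\to\mathbb{R}\cup\{+\infty\}$ satisfies the KL inequality at $x^*\in\mathrm{dom}(\partial f)$ if there exist $\nu>0$, a neighbourhood $V$ of $x^*$ and a continuous concave function $\xi:[0,\nu)\to[0,+\infty)$ with $\xi(0)=0$, $\xi$ of class $C^1$ on $(0,\nu)$, $\xi'(s)>0$ for all $s\in(0,\nu)$, such that $\xi'(f(x)-f(x^* ))\,\mathrm{dist}(0,\partial f(x))\ge1$ for all $x\in V$ with $f(x^* )<f(x)<f(x^* )+\nu$. If $f$ satisfies the KL inequality at every $x^*\in\mathrm{dom}(\partial f)$, then $f$ is called a KL function. *)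

(* Defs.v *)
From HB Require Import structures.
From mathcomp Require Export all_boot all_order all_algebra.
From mathcomp Require Export all_classical all_reals all_analysis.
Export Order.TTheory GRing.Theory Num.Theory numFieldNormedType.Exports.

Set Implicit Arguments.
Unset Strict Implicit.
Unset Printing Implicit Defensive.

Local Open Scope classical_set_scope.
Local Open Scope ring_scope.

Definition dotv (R : realType) (n : nat) (u v : 'rV[R]_n) : R :=
  \sum_i u 0 i * v 0 i.

(* The library norm of 'rV[R]_n is the sup norm: it induces the usual topology
   and the usual notions of boundedness and differentiability, which are taken
   from the library, but every quantitative norm below is this Euclidean one. *)
Definition enorm (R : realType) (n : nat) (u : 'rV[R]_n) : R :=
  Num.sqrt (dotv u u).

Definition grad (R : realType) (n : nat) (f : 'rV[R]_n -> R) (x : 'rV[R]_n) :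
    'rV[R]_n :=
  \row_i 'D_(delta_mx 0 i) f x.

Definition C1_on (R : realType) (n : nat) (f : 'rV[R]_n -> R)
    (A : set 'rV[R]_n) : Prop :=
  forall x, A x -> differentiable f x /\ {for x, continuous (grad f)}.

Definition elipschitz_on (R : realType) (n p : nat) (L : R)
    (A : set 'rV[R]_n) (g : 'rV[R]_n -> 'rV[R]_p) : Prop :=
  forall x y, A x -> A y -> enorm (g x - g y) <= L * enorm (x - y).

Local Open Scope ereal_scope.

Definition edom (R : realType) (T : Type) (f : T -> \bar R) : set T :=
  [set x | f x < +oo].

Definition eproper (R : realType) (T : Type) (f : T -> \bar R) : Prop :=
  (forall x, f x != -oo) /\ edom f !=set0.

Definition econvex (R : realType) (n : nat) (f : 'rV[R]_n -> \bar R) : Prop :=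
  forall (x y : 'rV[R]_n) (t : R), (0 < t < 1)%R ->
    f (t *: x + (1 - t) *: y)%R <= t%:E * f x + (1 - t)%:E * f y.

Definition prox (R : realType) (n : nat) (alpha : R) (f : 'rV[R]_n -> \bar R)
    (z : 'rV[R]_n) : set 'rV[R]_n :=
  let g y := f y + (enorm (y - z) ^+ 2 / (2 * alpha))%:E in
  [set p | forall y, g p <= g y].

Definition frechet_subdiff (R : realType) (n : nat) (f : 'rV[R]_n -> \bar R)
    (x : 'rV[R]_n) : set 'rV[R]_n :=
  [set v | f x \is a fin_num /\
    0 <= limf_einf (fun y : 'rV[R]_n =>
           (f y - f x - (dotv v (y - x))%:E) * ((enorm (y - x))^-1)%:E) x^'].

Definition limiting_subdiff (R : realType) (n : nat) (f : 'rV[R]_n -> \bar R)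
    (x : 'rV[R]_n) : set 'rV[R]_n :=
  [set v | f x \is a fin_num /\
    exists xs vs : nat -> 'rV[R]_n,
      [/\ xs j @[j --> \oo] --> x,
          f (xs j) @[j --> \oo] --> f x,
          vs j @[j --> \oo] --> v &
          forall j, frechet_subdiff f (xs j) (vs j)]].

(* ereal_inf makes the distance from 0 to the empty set equal to +oo. *)
Definition dist0 (R : realType) (n : nat) (A : set 'rV[R]_n) : \bar R :=
  ereal_inf [set (enorm v)%:E | v in A].

Definition desingularizing (R : realType) (nu : R) (xi : R -> R) : Prop :=
  [/\ (forall s, (0 <= s < nu)%R -> (0 <= xi s)%R),
      {within `[0%R, nu[, continuous xi},
      convex_function `[0%R, nu[%classic (fun s => - xi s)%R,
      xi 0%R = 0%R &
      forall s, (0 < s < nu)%R ->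
        [/\ derivable xi s 1, {for s, continuous (derive1 xi)} &
            (0 < derive1 xi s)%R]].

Definition KL_at (R : realType) (n : nat) (f : 'rV[R]_n -> \bar R)
    (xs : 'rV[R]_n) : Prop :=
  exists (nu : R) (V : set 'rV[R]_n) (xi : R -> R),
    [/\ (0 < nu)%R, nbhs xs V, desingularizing nu xi &
        forall x, V x -> f xs < f x < f xs + nu%:E ->
          1 <= (derive1 xi (fine (f x - f xs)))%:E * dist0 (limiting_subdiff f x)].

Definition KL_function (R : realType) (n : nat) (f : 'rV[R]_n -> \bar R) :
    Prop :=
  [/\ eproper f, lower_semicontinuous f &
      forall xs, limiting_subdiff f xs !=set0 -> KL_at f xs].

Definition obj (R : realType) (n : nat) (f0 : 'rV[R]_n -> R)
    (f1 : 'rV[R]_n -> \bar R) (x : 'rV[R]_n) : \bar R :=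
  (f0 x)%:E + f1 x.

(* The map (x, rho) |-> F x + rho^2/2, on R^n x R identified with R^(n+1). *)
Definition lifted (R : realType) (n : nat) (F : 'rV[R]_n -> \bar R)
    (z : 'rV[R]_(n + 1)) : \bar R :=
  F (lsubmx z) + (rsubmx z 0 0 ^+ 2 / 2)%:E.

(* U is extended-valued because Phi is evaluated at the combination
   t f1(y) + (1 - t) U, in which f1(y) : \bar R. *)
Definition Phi (R : realType) (n : nat) (f0 : 'rV[R]_n -> R)
    (x : 'rV[R]_n) (U : \bar R) : \bar R :=
  (f0 x)%:E + U.

Definition Hmodel (R : realType) (n : nat) (f0 : 'rV[R]_n -> R)
    (f1 : 'rV[R]_n -> \bar R) (alpha : R) (x y : 'rV[R]_n) : \bar R :=
  (dotv (grad f0 x) (y - x) + enorm (y - x) ^+ 2 / (2 * alpha))%:E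
    + f1 y - f1 x.

Definition Delta (R : realType) (n : nat) (f0 : 'rV[R]_n -> R)
    (f1 : 'rV[R]_n -> \bar R) (alpha U : R) (x y : 'rV[R]_n) : \bar R :=
  (dotv (grad f0 x) (y - x) + enorm (y - x) ^+ 2 / (2 * alpha))%:E
    + f1 y - U%:E.

(* Phi at the trial point of stepsize t. *)
Definition Phi_trial (R : realType) (n : nat) (f0 : 'rV[R]_n -> R)
    (f1 : 'rV[R]_n -> \bar R) (x y : 'rV[R]_n) (U t : R) : \bar R :=
  Phi f0 (x + t *: (y - x))%R (t%:E * f1 y + ((1 - t) * U)%:E).

Definition linesearch (R : realType) (n : nat) (f0 : 'rV[R]_n -> R)
    (f1 : 'rV[R]_n -> \bar R) (omega alpha : R) (x y : 'rV[R]_n) (U t : R) :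
    Prop :=
  mine (Phi_trial f0 f1 x y U t) (obj f0 f1 y)
    <= Phi f0 x U%:E + (omega * t)%:E * Delta f0 f1 alpha U x y.

(* Main.v *)
Require Import Defs.
From mathcomp Require Import ring lra.

(** Write F = f0 + f1, E k = f0 (x k) + U k, let P k >= 0 be the opposite of the
    predicted change [Delta] at iteration k, and D k its square root.

    One iteration. The proximal point yhat k minimizes a strongly convex model,
    and the inexactness criterion controls the model gap at ytilde k by P k.
    Hence yhat k and ytilde k lie within O(D k) of x k ([inexact_prox_bounds]).
    Linearizing f0 on the convex domain of f1 shows that all sufficiently small
    steps pass the line search ([linesearch_small_step]), so that the accepted
    steps are bounded below and E decreases by at least a fixed multiple of
    D k ^ 2; since E is bounded below, D tends to 0. The same linearization
    gives E (k + 1) <= F (ytilde k) <= F (yhat k) + O(P k) and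
    F (yhat k) <= E k + O(P k). Finally F has a subgradient of norm O(D k) at
    yhat k.

    Why a lifted function. The Kurdyka-Lojasiewicz inequality must be applied at
    points whose value is at least E (k + 1), because it is the decrease of E
    that one wants to compare with D. The value of F at yhat k may be smaller
    by O(P k). Adding rho k ^ 2 / 2 with rho k proportional to D k repairs this,
    and the corresponding subgradient (v k, rho k) still has norm O(D k).

    Convergence ([kl_descent_convergence]). Let l be a cluster point of the
    bounded sequence x, and e the limit of E. Lower semicontinuity and the
    minimality of yhat k give F l = e ([prox_gradient_closed]), so that 0 is a
    limiting subgradient of F at l. The Kurdyka-Lojasiewicz inequality at (l, 0)
    with desingularizing function xi gives, as long as x k is near l,
    D (k + 1) <= D k / 2 + psi (k + 1) - psi (k + 2) with psi k a multiple of
    xi (E k - e) ([desingularizing_decrease]). A Lyapunov argument shows that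
    the sequence, once it is close enough to l, never leaves a neighbourhood of
    l ([trapped_cvg]); since the neighbourhood is arbitrary, x converges to
    l. *)

Set Implicit Arguments.
Unset Strict Implicit.
Unset Printing Implicit Defensive.

Local Open Scope classical_set_scope.
Local Open Scope ring_scope.

(** * The Euclidean inner product and norm *)

Lemma dotvC (R : realType) n (u v : 'rV[R]_n) : dotv u v = dotv v u.
Proof. by apply: eq_bigr => i _; rewrite mulrC. Qed.

Lemma dotvDl (R : realType) n (u v w : 'rV[R]_n) :
  dotv (u + v) w = dotv u w + dotv v w.
Proof. by rewrite -big_split; apply: eq_bigr => i _; rewrite mxE mulrDl. Qed.

Lemma dotvZl (R : realType) n (a : R) (u v : 'rV[R]_n) :
  dotv (a *: u) v = a * dotv u v.
Proof. by rewrite mulr_sumr; apply: eq_bigr => i _; rewrite mxE mulrA. Qed.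

Lemma dotvNl (R : realType) n (u v : 'rV[R]_n) : dotv (- u) v = - dotv u v.
Proof. by rewrite -scaleN1r dotvZl mulN1r. Qed.

Lemma dotvBl (R : realType) n (u v w : 'rV[R]_n) :
  dotv (u - v) w = dotv u w - dotv v w.
Proof. by rewrite dotvDl dotvNl. Qed.

Lemma dotvDr (R : realType) n (u v w : 'rV[R]_n) :
  dotv w (u + v) = dotv w u + dotv w v.
Proof. by rewrite !(dotvC w) dotvDl. Qed.

Lemma dotvZr (R : realType) n (a : R) (u v : 'rV[R]_n) :
  dotv v (a *: u) = a * dotv v u.
Proof. by rewrite !(dotvC v) dotvZl. Qed.

Lemma dotvBr (R : realType) n (u v w : 'rV[R]_n) :
  dotv w (u - v) = dotv w u - dotv w v.
Proof. by rewrite !(dotvC w) dotvBl. Qed.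

Lemma dotv0l (R : realType) n (v : 'rV[R]_n) : dotv 0 v = 0.
Proof. by rewrite -(scale0r v) dotvZl mul0r. Qed.

Lemma dotv_ge0 (R : realType) n (u : 'rV[R]_n) : 0 <= dotv u u.
Proof. by apply: sumr_ge0 => i _; rewrite -expr2 sqr_ge0. Qed.

Lemma enorm_ge0 (R : realType) n (u : 'rV[R]_n) : 0 <= enorm u.
Proof. exact: sqrtr_ge0. Qed.
#[global] Hint Extern 0 (is_true (0 <= enorm _)) => exact: enorm_ge0 : core.

Lemma enorm_sqr (R : realType) n (u : 'rV[R]_n) : enorm u ^+ 2 = dotv u u.
Proof. by rewrite sqr_sqrtr ?dotv_ge0. Qed.

Lemma enormZ (R : realType) n (a : R) (u : 'rV[R]_n) :
  enorm (a *: u) = `|a| * enorm u.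
Proof.
by rewrite /enorm dotvZl dotvZr mulrA -expr2 sqrtrM ?sqr_ge0// sqrtr_sqr.
Qed.

Lemma enormN (R : realType) n (u : 'rV[R]_n) : enorm (- u) = enorm u.
Proof. by rewrite -scaleN1r enormZ normrN1 mul1r. Qed.

Lemma enorm_distC (R : realType) n (u v : 'rV[R]_n) :
  enorm (u - v) = enorm (v - u).
Proof. by rewrite -enormN opprB. Qed.

Lemma enormB_sqr (R : realType) n (u v : 'rV[R]_n) :
  enorm (u - v) ^+ 2 = enorm u ^+ 2 - 2 * dotv u v + enorm v ^+ 2.
Proof. by rewrite !enorm_sqr dotvBl !dotvBr (dotvC v u); ring. Qed.

Lemma enormD_sqr (R : realType) n (u v : 'rV[R]_n) :
  enorm (u + v) ^+ 2 = enorm u ^+ 2 + 2 * dotv u v + enorm v ^+ 2.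
Proof. by rewrite !enorm_sqr dotvDl !dotvDr (dotvC v u); ring. Qed.

Lemma abs_coord_le_enorm (R : realType) n (u : 'rV[R]_n) i : `|u 0 i| <= enorm u.
Proof.
rewrite -sqrtr_sqr ler_wsqrtr// /dotv (bigD1 i)//= expr2 lerDl.
by apply: sumr_ge0 => j _; rewrite -expr2 sqr_ge0.
Qed.

(** This bound and [enorm_le_norm] transfer limits between the topology, which
    comes from the sup norm, and Euclidean estimates. *)
Lemma norm_le_enorm (R : realType) n (u : 'rV[R]_n) : `|u| <= enorm u.
Proof.
rewrite /Num.norm/= mx_normrE.
apply: bigmax_le => [|[i j] _ /=]; first exact: enorm_ge0.
by rewrite ord1 abs_coord_le_enorm.
Qed.

Lemma enorm_eq0 (R : realType) n (u : 'rV[R]_n) : enorm u = 0 -> u = 0.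
Proof.
by move=> u0; apply/eqP; rewrite -normr_le0 -[leRHS]u0 norm_le_enorm.
Qed.

Lemma enorm_le_norm (R : realType) n (u : 'rV[R]_n) : enorm u <= n%:R * `|u|.
Proof.
rewrite -[leRHS]ger0_norm ?mulr_ge0// -sqrtr_sqr ler_wsqrtr//.
have coord i : u 0 i * u 0 i <= `|u| ^+ 2.
  rewrite -expr2 -real_normK ?num_real// lerXn2r ?nnegrE//.
  rewrite {2}/Num.norm/= mx_normrE.
  by apply/bigmax_geP; right; exists (0, i).
apply: (@le_trans _ _ (\sum_(i < n) `|u| ^+ 2)); first exact: ler_sum.
rewrite sumr_const card_ord exprMn -[leLHS]mulr_natl ler_wpM2r ?exprn_ge0//.
by rewrite -natrX ler_nat; case: n {u coord} => // n; rewrite leq_pmulr.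
Qed.

Lemma cauchy_schwarz (R : realType) n (u v : 'rV[R]_n) :
  `|dotv u v| <= enorm u * enorm v.
Proof.
have [v0|v0] := eqVneq (enorm v) 0.
  by rewrite (enorm_eq0 v0) dotvC dotv0l normr0 mulr_ge0.
have vgt0 : 0 < enorm v by rewrite lt_neqAle eq_sym v0 enorm_ge0.
rewrite -ler_sqr ?nnegrE ?mulr_ge0// real_normK ?num_real// exprMn.
have := sqr_ge0 (enorm (enorm v ^+ 2 *: u - dotv u v *: v)).
rewrite enormB_sqr !enormZ dotvZl dotvZr !exprMn !real_normK ?num_real//.
set a := enorm u; set b := enorm v; set c := dotv u v => H.
have {}H : 0 <= b ^+ 2 * (a ^+ 2 * b ^+ 2 - c ^+ 2) by move: H; lra.
by move: H; rewrite pmulr_rge0 ?exprn_gt0// subr_ge0.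
Qed.

Lemma enormD (R : realType) n (u v : 'rV[R]_n) :
  enorm (u + v) <= enorm u + enorm v.
Proof.
rewrite -ler_sqr ?nnegrE ?addr_ge0// enormD_sqr.
have := cauchy_schwarz u v; have := ler_norm (dotv u v); nra.
Qed.

Lemma enormB (R : realType) n (u v : 'rV[R]_n) :
  enorm (u - v) <= enorm u + enorm v.
Proof. by rewrite -(enormN v) enormD. Qed.

Lemma dotv_row_mx (R : realType) n p (u v : 'rV[R]_n) (a b : 'rV[R]_p) :
  dotv (row_mx u a) (row_mx v b) = dotv u v + dotv a b.
Proof.
rewrite /dotv big_split_ord/=; congr (_ + _); apply: eq_bigr => i _.
  by rewrite !row_mxEl.
by rewrite !row_mxEr.
Qed.

Lemma enorm_row_mx (R : realType) n (v : 'rV[R]_n) (rho : R) :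
  enorm (row_mx v (rho%:M : 'rV[R]_1)) <= enorm v + `|rho|.
Proof.
rewrite -ler_sqr ?nnegrE ?addr_ge0// enorm_sqr dotv_row_mx -enorm_sqr.
rewrite [X in _ + X <= _]/dotv big_ord1 !mxE eqxx mulr1n sqrrD.
rewrite real_normK ?num_real//.
by rewrite -expr2 lerD2r lerDl mulrn_wge0 ?mulr_ge0.
Qed.

Lemma enorm_lsubmx (R : realType) n (u : 'rV[R]_(n + 1)) :
  enorm (lsubmx u) <= enorm u.
Proof.
rewrite ler_wsqrtr// /dotv big_split_ord/= -[leLHS]addr0 lerD//.
  by apply: ler_sum => i _; rewrite !mxE.
by apply: sumr_ge0 => i _; rewrite -expr2 sqr_ge0.
Qed.

(** * First-order expansion along segments *)

Lemma derive_dotv_grad (R : realType) n (f : 'rV[R]_n -> R) (x v : 'rV[R]_n) :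
  differentiable f x -> 'D_v f x = dotv (grad f x) v.
Proof.
move=> fx; rewrite deriveE// [in LHS](row_sum_delta v) linear_sum.
apply: eq_bigr => i _; by rewrite linearZ /= mxE deriveE// mulrC.
Qed.

Lemma mvt_segment (R : realType) n (f : 'rV[R]_n -> R) (x y : 'rV[R]_n) :
  (forall t : R, 0 <= t <= 1 -> differentiable f (x + t *: (y - x))) ->
  exists2 t : R, 0 <= t <= 1 &
    f y - f x = dotv (grad f (x + t *: (y - x))) (y - x).
Proof.
move=> fd; pose h (t : R) := f (x + t *: (y - x)).
have hd (t : R) : 0 <= t <= 1 ->
    is_derive t (1 : R) h (dotv (grad f (x + t *: (y - x))) (y - x)).
  move=> /fd fdt; rewrite -derive_dotv_grad//.
  have E : (fun s : R => s^-1 *: ((h \o shift t) (s *: 1) - h t)) =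
      (fun s : R => s^-1 *: ((f \o shift (x + t *: (y - x))) (s *: (y - x))
                             - f (x + t *: (y - x)))).
    apply/funext => s /=; rewrite /h; congr (_ *: (f _ - _)).
    by rewrite [s *: 1]mulr1 scalerDl addrCA.
  split.
    by rewrite /derivable E; apply: diff_derivable.
  by rewrite /derive E.
have [||t t01] := @MVT_segment _ h
    (fun t => dotv (grad f (x + t *: (y - x))) (y - x)) 0 1 ler01.
- by move=> t; rewrite in_itv/= => /andP[t0 t1]; apply: hd; rewrite !ltW.
- apply: derivable_within_continuous => t; rewrite in_itv/= => t01.
  exact: (ex_derive (is_derive := hd t t01)).
rewrite /h scale1r scale0r addr0 subrKC subr0 mulr1 => E.
by exists t => //; move: t01; rewrite in_itv.
Qed.

(** The mean value theorem on the segment suffices: the gradient at the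
    intermediate point differs from the gradient at x by at most L times the
    length of the segment. Only the convex domain of the nonsmooth term is
    available for the Lipschitz bound, hence the segment hypothesis. The
    constant is twice that of the integral form, which is harmless here. *)
Lemma linearization_error (R : realType) n (f : 'rV[R]_n -> R)
    (A : set 'rV[R]_n) (L : R) (x y : 'rV[R]_n) :
    0 <= L -> elipschitz_on L A (grad f) ->
    (forall t : R, 0 <= t <= 1 -> A (x + t *: (y - x))) ->
    (forall z, A z -> differentiable f z) ->
  `|f y - f x - dotv (grad f x) (y - x)| <= L * enorm (y - x) ^+ 2.
Proof.
move=> L0 lipf segA fd.
have [t t01 ->] : exists2 t : R, 0 <= t <= 1 &
    f y - f x = dotv (grad f (x + t *: (y - x))) (y - x).
  by apply: mvt_segment => t /segA /fd.
have Ax : A x by have := segA 0; rewrite scale0r addr0; apply; rewrite lexx ler01.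
rewrite -dotvBl (le_trans (cauchy_schwarz _ _))// expr2 mulrA ler_wpM2r//.
rewrite (le_trans (lipf _ _ (segA _ t01) Ax))// ler_wpM2l//.
rewrite addrC addKr enormZ; case/andP: t01 => t0 t1.
by rewrite ger0_norm// ler_piMl.
Qed.

(** * Convex functions and proximal points *)

Lemma edom_fineK (R : realType) (T : Type) (f : T -> \bar R) x :
  eproper f -> edom f x -> f x = (fine (f x))%:E.
Proof.
move=> [/(_ x) fNy _] /= fxy; rewrite fineK// fin_numE fNy/=.
by move: fxy; rewrite /edom/= lt_neqAle => /andP[].
Qed.

Lemma edom_le (R : realType) (T : Type) (f : T -> \bar R) x (r : R) :
  eproper f -> (f x <= r%:E)%E -> edom f x /\ fine (f x) <= r.
Proof.
move=> fp fxr; have fx : edom f x by rewrite /edom/= (le_lt_trans fxr)// ltry.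
by split => //; move: fxr; rewrite (edom_fineK fp fx) lee_fin.
Qed.

Lemma econvex_segment (R : realType) n (f : 'rV[R]_n -> \bar R)
    (x y : 'rV[R]_n) (t : R) :
    eproper f -> econvex f -> edom f x -> edom f y -> 0 <= t <= 1 ->
  edom f (x + t *: (y - x)) /\
  fine (f (x + t *: (y - x))) <= (1 - t) * fine (f x) + t * fine (f y).
Proof.
move=> fp fc fx fy /andP[t0 t1].
have [->|tN0] := eqVneq t 0.
  by rewrite scale0r addr0 subr0 mul1r mul0r addr0.
have [->|tN1] := eqVneq t 1.
  by rewrite scale1r subrKC subrr mul1r mul0r add0r.
have t01 : 0 < t < 1 by rewrite !lt_neqAle eq_sym tN0 t0 tN1 t1.
have := fc y x t t01; have -> : t *: y + (1 - t) *: x = x + t *: (y - x).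
  by rewrite scalerBl scalerBr scale1r addrCA.
rewrite (edom_fineK fp fx) (edom_fineK fp fy) -!EFinM -EFinD => /(edom_le fp)[].
by rewrite [X in _ -> _ -> _ /\ _ <= X]addrC.
Qed.

Lemma prox_edom (R : realType) n (alpha : R) (f : 'rV[R]_n -> \bar R) z p :
  eproper f -> prox alpha f z p -> edom f p.
Proof.
move=> fp pp; have [_ [y fy]] := fp; have := pp y.
rewrite (edom_fineK fp fy) -EFinD => le.
rewrite /edom/= -(lteD2rE (x := (enorm (p - z) ^+ 2 / (2 * alpha))%:E))//.
by rewrite addye// (le_lt_trans le)// ltry.
Qed.

Lemma affine_ge0 (R : realType) (s d : R) :
  (forall t, 0 < t <= 1 -> 0 <= s + t * d) -> 0 <= s.
Proof.
move=> sd; apply/ler_addgt0Pr => e e0.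
have d1 : 0 < `|d| + 1 by rewrite ltr_wpDl.
pose t := Num.min 1 (e / (`|d| + 1)).
have t0 : 0 < t by rewrite lt_min ltr01 divr_gt0.
have /sd : 0 < t <= 1 by rewrite t0 ge_min lexx.
move/le_trans; apply; rewrite lerD2l.
have : t * (`|d| + 1) <= e by rewrite -ler_pdivlMr// ge_min lexx orbT.
by have := ler_norm d; nra.
Qed.

(** Fermat's rule for the proximal problem, with the convex subgradient
    inequality written between finite values. It yields both the strong
    convexity estimate [model_prox_growth] and the subgradients of the
    objective at proximal points. *)
Lemma prox_subgradient (R : realType) n (alpha : R) (f : 'rV[R]_n -> \bar R)
    z p y :
    eproper f -> econvex f -> 0 < alpha -> prox alpha f z p -> edom f y ->
  fine (f p) + dotv (alpha^-1 *: (z - p)) (y - p) <= fine (f y).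
Proof.
move=> fp fc a0 pp fy; have fpp := prox_edom fp pp.
rewrite dotvZl; set c := dotv _ _; set e := enorm (y - p) ^+ 2.
(* Moving from p towards y by t changes the proximal objective by a quadratic
   polynomial in t vanishing at 0; its slope there must be nonnegative. *)
have slope t : 0 < t <= 1 ->
    0 <= fine (f y) - fine (f p) - alpha^-1 * c + t * (e / (2 * alpha)).
  move=> /andP[t0 t1].
  have [fq leq] := econvex_segment fp fc fpp fy (t := t) ltac:(by rewrite ltW).
  have := pp (p + t *: (y - p)).
  rewrite (edom_fineK fp fq) (edom_fineK fp fpp) -!EFinD lee_fin.
  have -> : enorm (p + t *: (y - p) - z) ^+ 2 =
      enorm (p - z) ^+ 2 + 2 * (t * - c) + t ^+ 2 * e.
    rewrite addrAC [LHS]enormD_sqr dotvZr -[p - z]opprB dotvNl -/c enormN.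
    by rewrite enormZ exprMn real_normK ?num_real.
  move=> le.
  have {}le : fine (f p) <= fine (f (p + t *: (y - p))) +
      ((2 * (t * - c)) + t ^+ 2 * e) / (2 * alpha).
    by move: le; rewrite !mulrDl; lra.
  rewrite -(pmulr_rge0 _ t0).
  have E : ((2 * (t * - c)) + t ^+ 2 * e) / (2 * alpha) =
      t * (- (alpha^-1 * c) + t * (e / (2 * alpha))).
    by field; rewrite gt_eqF.
  by rewrite E in le; lra.
by have := affine_ge0 slope; lra.
Qed.

(** * Regular and limiting subgradients *)

(** The inequality form of the Frechet subdifferential; unlike the lower limit
    of difference quotients it adds up by inspection. *)
Definition regular_subgradient (R : realType) n (f : 'rV[R]_n -> \bar R)
    (x v : 'rV[R]_n) : Prop :=
  f x \is a fin_num /\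
  forall e : R, 0 < e -> \forall y \near x,
    (f x + (dotv v (y - x) - e * enorm (y - x))%:E <= f y)%E.

Lemma regular_frechet (R : realType) n (f : 'rV[R]_n -> \bar R) x v :
  regular_subgradient f x v -> frechet_subdiff f x v.
Proof.
move=> [fx reg]; split => //; rewrite /limf_einf oppe_ge0.
apply/lee_addgt0Pr => e e0; rewrite add0e.
have /nbhs_ballP[r /= r0 rP] := reg e e0.
pose q (y : 'rV[R]_n) :=
  ((f y - f x - (dotv v (y - x))%:E) * ((enorm (y - x))^-1)%:E)%E.
apply: (@le_trans _ _ (ereal_sup ((\- q)%E @` (ball x r `\ x)))).
  apply: ereal_inf_lbound; exists (ball x r `\ x) => //.
  by apply/nbhs_ballP; exists r => //= y xy /eqP ; split => //; apply/eqP.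
apply: ge_ereal_sup => _ [y [/rP yP /eqP yx] <-]/=.
have exy : 0 < enorm (y - x).
  rewrite lt_neqAle enorm_ge0 andbT eq_sym; apply/eqP => /enorm_eq0/eqP.
  by rewrite subr_eq0 (negbTE yx).
rewrite /q; move: fx yP; case: (f x) => // a _; rewrite -EFinD.
case: (f y) => [s| |] //=; rewrite ?lee_fin.
  by move=> le; rewrite -mulNr ler_pdivrMr//; lra.
by rewrite !addye// gt0_mulye ?lte_fin ?invr_gt0// leNye.
Qed.

Lemma frechet_limiting (R : realType) n (f : 'rV[R]_n -> \bar R) x v :
  frechet_subdiff f x v -> limiting_subdiff f x v.
Proof.
move=> fxv; split; first by case: fxv.
by exists (fun=> x), (fun=> v); split => //; apply: cvg_cst.
Qed.

(** Sum rule: the convex subgradient inequality of the nonsmooth term is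
    global, so the first-order error of the smooth term is the only one. *)
Lemma obj_regular (R : realType) n (f0 : 'rV[R]_n -> R)
    (f1 : 'rV[R]_n -> \bar R) x w :
    eproper f1 -> differentiable f0 x -> edom f1 x ->
    (forall y, edom f1 y -> fine (f1 x) + dotv w (y - x) <= fine (f1 y)) ->
  regular_subgradient (obj f0 f1) x (grad f0 x + w).
Proof.
move=> fp fd fx wsub; split; first by rewrite /obj (edom_fineK fp fx).
move=> e e0.
have : \forall y \near x,
    `|f0 y - f0 x - dotv (grad f0 x) (y - x)| <= e * `|y - x|.
  have := diff_locally fd; rewrite eqaddoP => /(_ e e0)/= near0.
  rewrite (near_shift 0) subr0; apply: filterS near0 => h /=.
  by rewrite -derive_dotv_grad// deriveE// addrK !fctE /= opprD addrA.
apply: filterS => y yP.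
have [fy|fy] := ltP (f1 y) +oo%E; last first.
  by rewrite /obj (eqP (etrans (esym (leye_eq _)) fy)) addey// leey.
rewrite /obj (edom_fineK fp fx) (edom_fineK fp fy) -!EFinD lee_fin.
rewrite dotvDl.
have := wsub y fy; have : e * `|y - x| <= e * enorm (y - x).
  by rewrite ler_wpM2l ?norm_le_enorm// ltW.
by move: yP; rewrite ler_norml => /andP[]; lra.
Qed.

(** The quadratic term is convex with derivative rho, so it adds rho as a last
    coordinate to any regular subgradient. *)
Lemma lifted_regular (R : realType) n (F : 'rV[R]_n -> \bar R) x v (rho : R) :
  regular_subgradient F x v ->
  regular_subgradient (lifted F) (row_mx x rho%:M) (row_mx v rho%:M).
Proof.
move=> [Fx reg]; split.
  by rewrite /lifted row_mxKl fin_numD Fx.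
move=> e e0; have := reg e e0.
have lcont : (lsubmx (z : 'rV[R]_(n + 1))) @[z --> row_mx x rho%:M] --> x.
  rewrite -[X in _ --> X](row_mxKl x (rho%:M)); exact: continuous_lsubmx.
move/lcont => nearz.
have {nearz} : \forall z \near row_mx x rho%:M, (F x + (dotv v (lsubmx z - x) -
    e * enorm (lsubmx z - x))%:E <= F (lsubmx z))%E := nearz.
apply: filterS => z zP.
rewrite /lifted row_mxKl row_mxKr.
case: (F x) Fx zP => // a _ zP; rewrite -!EFinD in zP *.
have -> : dotv (row_mx v rho%:M) (z - row_mx x rho%:M) =
    dotv v (lsubmx z - x) + rho * (rsubmx z 0 0 - rho).
  rewrite -{1}[z]hsubmxK opp_row_mx add_row_mx dotv_row_mx; congr (_ + _).
  by rewrite /dotv big_ord1 !mxE eqxx mulr1n.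
have := enorm_lsubmx (z - row_mx x rho%:M).
rewrite linearB/= row_mxKl => /(ler_wpM2l (ltW e0)).
have := sqr_ge0 (rsubmx z 0 0 - rho).
have -> : (rho%:M : 'rV[R]_1) 0 0 = rho by rewrite mxE eqxx mulr1n.
rewrite sqrrB.
case: (F (lsubmx z)) zP => [s| |]//; rewrite -?EFinD ?lee_fin.
  lra.
by rewrite addye// => _ _ _; exact: leey.
Qed.

(** * Desingularizing functions *)

(** A concave function lies below its tangents: the difference quotients of xi
    at s towards a dominate the chord slope, and tend to the derivative. *)
Lemma desingularizing_tangent (R : realType) (nu : R) xi s a :
  desingularizing nu xi -> 0 < s < nu -> 0 <= a < nu ->
  xi a <= xi s + derive1 xi s * (a - s).
Proof.
move=> [_ _ conc _ dxi] snu anu; have [ds _ _] := dxi s snu.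
have ds' : differentiable xi s by apply/derivable1_diffP.
have sI : s \in (`[0, nu[%classic : set R).
  by rewrite inE/= in_itv/=; case/andP: snu => /ltW -> ->.
have aI : a \in (`[0, nu[%classic : set R) by rewrite inE/= in_itv.
have -> : derive1 xi s * (a - s) = 'D_(a - s) xi s.
  have -> : a - s = (a - s) *: (1 : R) by rewrite [_ *: _]mulr1.
  by rewrite deriveE// linearZ/= -deriveE// -derive1E mulrC [_ *: 1]mulr1.
rewrite -lerBlDl; have := @diff_derivable _ _ _ _ _ (a - s) ds'.
move=> /cvg_ex[/= d dP].
rewrite /derive (cvg_lim (@Rhausdorff R) dP).
apply: (cvgr_to_ge (cvg_dnbhs_at_right dP)).
near=> t.
have t0 : 0 < t by [].
have t1 : t <= 1 by near: t; exact: nbhs_right_le.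
have := conc (Itv01 (ltW t0) t1) a s aI sI.
rewrite convRE/=.
have -> : conv (Itv01 (ltW t0) t1) (a : convex_lmodType R^o) s = t * (a - s) + s.
  by rewrite -[LHS]/(t * a + (1 - t) * s); ring.
rewrite -[t *: _]/(t * _) -[t^-1 *: _]/(t^-1 * _) /unstable.onem => le.
by rewrite mulrC ler_pdivlMr//; lra.
Unshelve. all: by end_near.
Qed.

(** This turns a Kurdyka-Lojasiewicz inequality at level s into a bound on a
    decrease of the values from a to b at levels below s. The derivative of xi
    is nonincreasing, so the inequality at s passes to a, and concavity bounds
    the increment of xi from below by its derivative at a times a - b. The gap
    between a and s lets the inequality be used at a point whose value exceeds
    that of the iterate. *)
Lemma desingularizing_decrease (R : realType) (nu : R) xi s a b w :
    desingularizing nu xi -> 0 <= b <= a -> 0 < a <= s -> s < nu -> 0 <= w ->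
    1 <= derive1 xi s * w ->
  a - b <= w * (xi a - xi b).
Proof.
move=> dxi /andP[b0 ba] /andP[a0 lea] snu w0 sw.
have anu : 0 < a < nu by rewrite a0 (le_lt_trans lea).
have bnu : 0 <= b < nu by rewrite b0 (le_lt_trans ba)//; case/andP: anu.
have s0nu : 0 < s < nu by rewrite (lt_le_trans a0).
have tab := desingularizing_tangent dxi anu bnu.
have tas : xi s <= xi a + derive1 xi a * (s - a).
  by apply: (desingularizing_tangent dxi anu); rewrite snu andbT ltW// (lt_le_trans a0).
have tsa : xi a <= xi s + derive1 xi s * (a - s).
  by apply: (desingularizing_tangent dxi s0nu); case/andP: anu => /ltW -> ->.
have mono : derive1 xi s <= derive1 xi a.
  have [->//|] := eqVneq a s; rewrite neq_lt [s < a]ltNge lea orbF -subr_gt0.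
  by move=> sa; rewrite -(ler_pM2r sa); lra.
have ma : (a - b) * derive1 xi s <= xi a - xi b.
  by apply: (@le_trans _ _ ((a - b) * derive1 xi a)); [rewrite ler_wpM2l//|]; lra.
have : (a - b) * 1 <= (a - b) * (derive1 xi s * w).
  by rewrite ler_wpM2l// subr_ge0.
have := ler_wpM2l w0 ma; lra.
Qed.

Lemma desingularizing_cvg0 (R : realType) (nu : R) xi (u : nat -> R) :
    desingularizing nu xi -> 0 < nu -> (forall k, 0 <= u k) -> u @ \oo --> 0 ->
  xi (u k) @[k --> \oo] --> 0.
Proof.
move=> [_ /subspace_continuousP xic _ xi0 _] nu0 u0 ulim.
have zI : [set` `[0, nu[] (0 : R) by rewrite /= in_itv/= lexx.
rewrite -xi0; have := xic 0 zI; apply: cvg_comp => A.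
move=> /ulim /= Au.
have unu : \forall k \near \oo, u k < nu by apply: (cvgr_lt 0).
near=> k; have kI : [set` `[0, nu[] (u k) by rewrite /= in_itv/= u0; near: k.
by move: kI; near: k.
Unshelve. all: by end_near.
Qed.

(** * Sequences trapped near a cluster point *)

(** The quantity |X k - l| + c (2 D k + 2 psi (k + 1)) does not increase as long
    as X k stays within r of l, by the recursive bound on D. It becomes
    arbitrarily small at an index where X k is close to the cluster point l,
    and from there on it keeps the sequence close to l. Thus convergence to l
    comes without summing the steps. *)
Lemma trapped_cvg (R : realType) (V : normedModType R) (X : nat -> V)
    (D psi : nat -> R) (c r : R) (l : V) :
    0 <= c -> 0 < r -> (forall k, 0 <= D k) -> D @ \oo --> 0 ->
    (\forall k \near \oo, 0 <= psi k) -> psi @ \oo --> 0 ->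
    (forall k, `|X k.+1 - X k| <= c * D k) ->
    (\forall k \near \oo, `|X k - l| < r ->
       D k.+1 <= D k / 2 + (psi k.+1 - psi k.+2)) ->
    cluster (X @ \oo) l ->
  X @ \oo --> l.
Proof.
move=> c0 r0 D0 Dlim psi0 psilim XD step Xl.
apply/cvgrPdist_lt => e e0; pose rho := Num.min e r.
have rho0 : 0 < rho by rewrite lt_min e0 r0.
(* With D and psi below h, the second term of Q below is at most
   4 c h < rho / 2. *)
pose h := rho / (8 * (c + 1)).
have h0 : 0 < h by rewrite divr_gt0// mulr_gt0// ltr_wpDl.
have small : \forall k \near \oo, [/\ D k < h, psi k.+1 < h, 0 <= psi k.+1 &
    `|X k - l| < r -> D k.+1 <= D k / 2 + (psi k.+1 - psi k.+2)].
  have psiS : psi k.+1 @[k --> \oo] --> 0 by rewrite (cvg_shiftS psi (nbhs 0)).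
  have psiS0 : \forall k \near \oo, 0 <= psi k.+1.
    by have [N _ NP] := psi0; exists N => // k Nk; apply: NP; apply: leqW.
  near=> k; split; last by near: k.
  - by near: k; apply: (cvgr_lt 0).
  - by near: k; apply: (cvgr_lt 0).
  - by near: k.
have [N _ NP] := small.
pose Q k := `|X k - l| + c * (2 * D k + 2 * psi k.+1).
have [K NK XK] : exists2 K, (N <= K)%N & `|X K - l| < rho / 4.
  have [] := Xl (X @` [set k | (N <= k)%N]) (ball l (rho / 4)).
  - by exists N => // k Nk; exists k.
  - by apply: nbhsx_ballx; rewrite divr_gt0.
  by move=> _ [[k Nk <-]]; rewrite -ball_normE/= distrC; exists k.
have QK j : Q (K + j)%N < rho.
  elim: j => [|j].
    rewrite addn0 /Q; have [? ? ? _] := NP K NK.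
    have ch : 8 * (c * h) < rho.
      rewrite /h !mulrA ltr_pdivrMr ?mulr_gt0 ?ltr_wpDl//; nra.
    nra.
  have NKj : (N <= K + j)%N by rewrite (leq_trans NK)// leq_addr.
  rewrite addnS; set k := (K + j)%N in NKj *.
  have [_ _ p1 st] := NP k NKj; have [_ _ p2 _] := NP k.+1 (leqW NKj).
  move=> Qk; have Xk : `|X k - l| < rho.
    by apply: le_lt_trans Qk; rewrite lerDl mulr_ge0// addr_ge0// mulr_ge0.
  have := st (lt_le_trans Xk _); rewrite ge_min lexx orbT => /(_ isT) Dk.
  have tri : `|X k.+1 - l| <= `|X k - l| + c * D k.
    rewrite -(subrK (X k) (X k.+1)) -addrA addrC (le_trans (ler_normD _ _))//.
    by rewrite lerD2l.
  apply: le_lt_trans Qk; rewrite /Q; nra.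
exists K => // k Kk; rewrite distrC.
have := QK (k - K)%N; rewrite subnKC// /Q => Qk.
have [_ _ p _] := NP k (leq_trans NK Kk).
have : `|X k - l| < rho.
  by apply: le_lt_trans Qk; rewrite lerDl mulr_ge0// addr_ge0// mulr_ge0.
by rewrite lt_min => /andP[].
Unshelve. all: by end_near.
Qed.

Lemma cluster_subseq (R : realType) (V : normedModType R) (X : nat -> V) l :
  cluster (X @ \oo) l ->
  exists2 s : nat -> nat, s @ \oo --> \oo & X (s j) @[j --> \oo] --> l.
Proof.
move=> Xl.
have /choice[s sP] : forall j : nat, exists k, (j <= k)%N /\ `|X k - l| < j.+1%:R^-1.
  move=> j; have [] := Xl (X @` [set k | (j <= k)%N]) (ball l j.+1%:R^-1).
  - by exists j => // k Nk; exists k.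
  - by apply: nbhsx_ballx; rewrite invr_gt0.
  by move=> _ [[k Nk <-]]; rewrite -ball_normE/= distrC; exists k.
exists s.
  apply/cvgnyPge => N; near=> j; apply: leq_trans (proj1 (sP j)).
  by near: j; exact: nbhs_infty_ge.
apply/cvgrPdist_lt => e e0; near=> j; rewrite distrC.
apply: lt_trans (proj2 (sP j)) _; near: j; exact: near_infty_natSinv_lt (PosNum e0).
Unshelve. all: by end_near.
Qed.

Lemma bounded_seq_cluster (R : realType) n (X : nat -> 'rV[R]_n) :
  bounded_set (range X) -> exists l, cluster (X @ \oo) l.
Proof.
move=> [M [Mreal HM]].
have cl : compact (closed_ball (0 : 'rV[R]_n) (`|M| + 1)).
  apply: bounded_closed_compact; last exact: closed_ball_closed.
  exists (`|M| + 1); split; first exact: num_real.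
  move=> y My x /=; rewrite closed_ballE ?ltr_wpDl//= /closed_ball_/= sub0r normrN.
  by move=> /le_trans; apply; apply: ltW.
have [|l [_ Xl]] := cl (X @ \oo) _; last by exists l.
exists 0%N => // k _; rewrite closed_ballE ?ltr_wpDl//= /closed_ball_/= sub0r normrN.
by apply: (HM (`|M| + 1)); [rewrite ltr_pwDr// ler_norm|exists k].
Qed.

(** * Descent under the Kurdyka-Lojasiewicz property *)

Lemma enorm_squeeze_cvg (R : realType) n (u : nat -> 'rV[R]_n) (l : 'rV[R]_n)
    (w : nat -> R) :
  (forall k, enorm (u k - l) <= w k) -> w @ \oo --> 0 -> u @ \oo --> l.
Proof.
move=> uw w0; apply/cvgrPdist_lt => e e0; near=> k; rewrite distrC.
apply: le_lt_trans (norm_le_enorm _) _; apply: le_lt_trans (uw k) _.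
by near: k; apply: (cvgr_lt 0).
Unshelve. all: by end_near.
Qed.

Lemma enorm_cvg0 (R : realType) n (u : nat -> 'rV[R]_n) (l : 'rV[R]_n) :
  u @ \oo --> l -> enorm (u k - l) @[k --> \oo] --> 0.
Proof.
move=> ul; apply: (@squeeze_cvgr _ _ _ _ (fun=> 0) (fun k => n%:R * `|u k - l|)).
- by near=> k; rewrite enorm_ge0 enorm_le_norm.
- exact: cvg_cst.
- rewrite -[X in _ --> X](mulr0 n%:R); apply: cvgMr.
  rewrite -(@normr0 _ 'rV[R]_n) -(subrr l); apply: cvg_norm.
  by apply: cvgB => //; exact: cvg_cst.
Unshelve. all: by end_near.
Qed.

Lemma cvg_sqr_squeeze (R : realType) (D w : nat -> R) (a : R) :
  0 < a -> (forall k, 0 <= D k) -> (forall k, a * D k ^+ 2 <= w k) ->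
  w @ \oo --> 0 -> D @ \oo --> 0.
Proof.
move=> a0 D0 Dw w0; apply/cvgrPdist_lt => e e0; near=> k.
rewrite sub0r normrN ger0_norm// ltNge; apply/negP => eD.
have : w k < a * e ^+ 2.
  by near: k; apply: (cvgr_lt 0) => //; rewrite mulr_gt0 ?exprn_gt0.
have := Dw k; have : e ^+ 2 <= D k ^+ 2 by rewrite lerXn2r// nnegrE// ltW.
by nra.
Unshelve. all: by end_near.
Qed.

Lemma dist0_le (R : realType) n (A : set 'rV[R]_n) v :
  A v -> (dist0 A <= (enorm v)%:E)%E.
Proof. by move=> Av; apply: ereal_inf_lbound; exists v. Qed.

(** E is a merit value that decreases by at least a multiple of the squared step
    length D, and y k is a point near x k where F has a subgradient of order D.
    The value of F at y k may be smaller than E (k + 1); the extra coordinate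
    rho k, also of order D, raises it above E (k + 1) in the lifted function.
    If e is the limit of E and l a cluster point, the
    Kurdyka-Lojasiewicz inequality at (l, 0), used at (y k, rho k), gives
    E (k + 1) - E (k + 2) <= 2 b D k (xi (E (k + 1) - e) - xi (E (k + 2) - e)),
    and the arithmetic-geometric mean inequality turns this into the recursion
    of [trapped_cvg]. The last hypothesis identifies F l with e, the level to
    which the inequality at (l, 0) refers. *)
Lemma kl_descent_convergence (R : realType) n (F : 'rV[R]_n -> \bar R)
    (x y v : nat -> 'rV[R]_n) (E rho D : nat -> R) (a b c Emin : R) :
    KL_function (lifted F) -> 0 < a -> 0 <= b -> 0 <= c ->
    (forall k, 0 <= D k) ->
    (forall k, a * D k ^+ 2 <= E k - E k.+1) ->
    (forall k, Emin <= E k) ->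
    (forall k, enorm (x k.+1 - x k) <= c * D k) ->
    (forall k, enorm (y k - x k) <= c * D k) ->
    (forall k, regular_subgradient F (y k) (v k)) ->
    (forall k, enorm (v k) <= b * D k) ->
    (forall k, `|rho k| <= b * D k) ->
    (forall k, E k.+1 <= fine (F (y k)) + rho k ^+ 2 / 2
                      <= E k + b * D k ^+ 2) ->
    bounded_set (range x) ->
    (forall (s : nat -> nat) (l : 'rV[R]_n) (e : R),
       x (s j) @[j --> \oo] --> l -> y (s j) @[j --> \oo] --> l ->
       fine (F (y (s j))) @[j --> \oo] --> e -> F l = e%:E) ->
  exists l : 'rV[R]_n, [/\ x @ \oo --> l, edom F l & limiting_subdiff F l 0].
Proof.
move=> [_ _ KL] a0 b0 c0 D0 dec Emin_le xD yD reg vD rhoD val bnd Fclosed.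
have Enoninc : nonincreasing_seq E.
  apply/nonincreasing_seqP => k; rewrite -subr_ge0 (le_trans _ (dec k))//.
  by rewrite mulr_ge0 ?sqr_ge0// ltW.
have Ecvg : cvgn E.
  by apply: nonincreasing_is_cvgn => //; exists Emin => _ [k _ <-].
pose e := limn E.
have eE k : e <= E k by apply: nonincreasing_cvgn_ge.
have EcvgS : E k.+1 @[k --> \oo] --> e by rewrite (cvg_shiftS E (nbhs e)).
have Dlim : D @ \oo --> 0.
  apply: (cvg_sqr_squeeze a0 D0 dec); rewrite -(subrr e); exact: cvgB.
have kD0 d : (d * D k) @[k --> \oo] --> 0.
  by rewrite -(mulr0 d); apply: cvgMr.
have D2lim d : (d * D k ^+ 2) @[k --> \oo] --> 0.
  have -> : (fun k => d * D k ^+ 2) = (fun k => d * D k * D k).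
    by apply/funext => k; rewrite expr2 mulrA.
  by rewrite -[X in _ --> X](mulr0 (0 : R)); apply: cvgM.
have valhi k : fine (F (y k)) + rho k ^+ 2 / 2 <= E k + b * D k ^+ 2.
  by case/andP: (val k).
have vallo k : E k.+1 <= fine (F (y k)) + rho k ^+ 2 / 2.
  by case/andP: (val k).
have EbD : (E k + b * D k ^+ 2) @[k --> \oo] --> e.
  by rewrite -[X in _ --> X](addr0 e); apply: cvgD.
have vallim : (fine (F (y k)) + rho k ^+ 2 / 2) @[k --> \oo] --> e.
  by apply: squeeze_cvgr EcvgS EbD; apply: nearW.
have Fylim : fine (F (y k)) @[k --> \oo] --> e.
  apply: (@squeeze_cvgr _ _ _ _ (fun k => E k.+1 - b ^+ 2 / 2 * D k ^+ 2)
            (fun k => E k + b * D k ^+ 2)).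
  - near=> k; apply/andP; split.
      have := vallo k; have : rho k ^+ 2 <= (b * D k) ^+ 2.
        by rewrite -[rho k ^+ 2]real_normK ?num_real// lerXn2r ?nnegrE ?mulr_ge0.
      by rewrite exprMn; lra.
    by have := valhi k; have := sqr_ge0 (rho k); lra.
  - by rewrite -(subr0 e); apply: cvgB.
  - by [].
have [l xl] := bounded_seq_cluster bnd.
have [s soo xsl] := cluster_subseq xl.
have ysl : y (s j) @[j --> \oo] --> l.
  apply: (@enorm_squeeze_cvg _ _ _ _ (fun j => enorm (x (s j) - l) + c * D (s j))).
    move=> j; rewrite -(subrK (x (s j)) (y (s j))) -addrA (le_trans (enormD _ _))//.
    by rewrite [leLHS]addrC lerD2l.
  rewrite -(addr0 0); apply: cvgD; first exact: enorm_cvg0.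
  exact: (cvg_comp _ _ soo (kD0 c)).
have Fysl : fine (F (y (s j))) @[j --> \oo] --> e by exact: (cvg_comp _ _ soo Fylim).
have Fl : F l = e%:E := Fclosed s l e xsl ysl Fysl.
have vsl : v (s j) @[j --> \oo] --> (0 : 'rV[R]_n).
  apply: (@enorm_squeeze_cvg _ _ _ _ (fun j => b * D (s j))).
    by move=> j; rewrite subr0.
  exact: (cvg_comp _ _ soo (kD0 b)).
have Fyfin k : F (y k) = (fine (F (y k)))%:E by have [h _] := reg k; rewrite fineK.
have Fcvg : F (y (s j)) @[j --> \oo] --> F l.
  by rewrite Fl; apply: cvg_EFin => //; apply: nearW => j; rewrite Fyfin.
exists l; split; last 2 first.
- by rewrite /edom/= Fl ltry.
- split; first by rewrite Fl.
  exists (y \o s), (v \o s); split => //= j; exact: regular_frechet.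
pose z k := row_mx (y k) (rho k)%:M : 'rV[R]_(n + 1).
pose zl := row_mx l (0 : R)%:M : 'rV[R]_(n + 1).
have Fz k : lifted F (z k) = (fine (F (y k)) + rho k ^+ 2 / 2)%:E.
  by rewrite /lifted row_mxKl row_mxKr Fyfin mxE eqxx mulr1n.
have Fzl : lifted F zl = e%:E.
  by rewrite /lifted row_mxKl row_mxKr Fl mxE eqxx mulr1n expr0n/= mul0r addr0.
have zdist k : enorm (z k - zl) <= enorm (y k - l) + `|rho k|.
  rewrite /z /zl opp_row_mx add_row_mx -raddfB/= subr0; exact: enorm_row_mx.
have /KL[nu [V [xi [nu0 Vz dxi ineq]]]] : limiting_subdiff (lifted F) zl !=set0.
  exists 0; split; first by rewrite Fzl.
  exists (z \o s), (fun j => row_mx (v (s j)) (rho (s j))%:M); split => /=.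
  - apply: (@enorm_squeeze_cvg _ _ _ _ (fun j => enorm (y (s j) - l) + b * D (s j))).
      by move=> j; rewrite (le_trans (zdist _))// lerD2l.
    rewrite -(addr0 0); apply: cvgD; first exact: enorm_cvg0.
    exact: (cvg_comp _ _ soo (kD0 b)).
  - rewrite Fzl; apply: cvg_EFin; first by apply: nearW => j; rewrite /= Fz.
    under eq_fun do rewrite /= Fz; exact: (cvg_comp _ _ soo vallim).
  - apply: (@enorm_squeeze_cvg _ _ _ _ (fun j => (b + b) * D (s j))).
      move=> j; rewrite subr0 (le_trans (enorm_row_mx _ _))// mulrDl.
      by rewrite lerD.
    exact: (cvg_comp _ _ soo (kD0 _)).
  - by move=> j; apply/regular_frechet/lifted_regular.
have /nbhs_ballP[r /= r0 rV] := Vz.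
pose psi k := b / a * xi (E k - e).
have gap0 : E k - e @[k --> \oo] --> 0.
  by rewrite -(subrr e); apply: cvgB => //; exact: cvg_cst.
pose r' := r / (2 * (n%:R + 1)).
have n1 : 0 < n%:R + 1 :> R by rewrite ltr_wpDl.
have r'0 : 0 < r' by rewrite divr_gt0// mulr_gt0.
apply: (@trapped_cvg _ _ x D psi c r') => //.
- near=> k; rewrite mulr_ge0 ?divr_ge0//; first exact: ltW.
  have [xi0 _ _ _ _] := dxi; apply: xi0; rewrite subr_ge0 eE/=.
  by near: k; apply: (cvgr_lt 0).
- rewrite -(mulr0 (b / a)); apply: cvgMr.
  by apply: desingularizing_cvg0 dxi nu0 _ gap0 => k; rewrite subr_ge0.
- by move=> k; apply: le_trans (norm_le_enorm _) (xD k).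
near=> k => xk.
(* If the limit value is attained the steps vanish from then on, and the
   Kurdyka-Lojasiewicz inequality, which concerns larger values, is void. *)
have [Eke|Eke] := eqVneq (E k.+1) e.
  have EkS : E k.+2 = e.
    by apply/eqP; rewrite eq_le eE andbT -Eke; apply: Enoninc.
  rewrite /psi Eke EkS subrr addr0.
  have := dec k.+1; rewrite Eke EkS subrr => dk.
  have -> : D k.+1 = 0.
    by apply/eqP; rewrite -sqrf_eq0 eq_le sqr_ge0 andbT -(pmulr_rle0 _ a0).
  by rewrite divr_ge0.
have eEk : e < E k.+1 by rewrite lt_neqAle eq_sym Eke eE.
have Vzk : V (z k).
  apply: rV; rewrite -ball_normE/= distrC.
  apply: le_lt_trans (norm_le_enorm _) _; apply: le_lt_trans (zdist k) _.
  have : enorm (y k - l) <= c * D k + n%:R * r'.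
    rewrite -(subrK (x k) (y k)) -addrA (le_trans (enormD _ _))// lerD//.
    by rewrite (le_trans (enorm_le_norm _))// ler_wpM2l// ltW.
  have : (n%:R + 1) * r' = r / 2.
    by rewrite /r'; field; rewrite gt_eqF.
  have : (c + b) * D k < r / 2 by near: k; apply: (cvgr_lt 0) => //; rewrite divr_gt0.
  have := rhoD k; lra.
have Fzk : (lifted F zl < lifted F (z k) < lifted F zl + nu%:E)%E.
  rewrite Fz Fzl -EFinD !lte_fin (lt_le_trans eEk)//=.
  apply: le_lt_trans (valhi k) _; rewrite -ltrBlDl addrAC.
  near: k; apply: (cvgr_lt 0) => //.
  by rewrite -(addr0 0); apply: cvgD.
have := ineq _ Vzk Fzk; rewrite Fz Fzl /= => KLk.
set t := fine (F (y k)) + _ - e in KLk.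
have tnu : 0 < t < nu.
  by move: Fzk; rewrite Fz Fzl -EFinD !lte_fin /t => /andP[]; lra.
have dxi0 : 0 < derive1 xi t by have [_ _ _ _ /(_ t tnu)[]] := dxi.
(* The subgradient (v k, rho k) bounds the distance from 0 to the
   subdifferential of the lifted function. *)
have KLr : 1 <= derive1 xi t * ((b + b) * D k).
  rewrite -lee_fin EFinM (le_trans KLk)// lee_pmul2l ?lte_fin//.
  apply: le_trans (dist0_le (frechet_limiting (regular_frechet
    (lifted_regular (rho k) (reg k))))) _.
  by rewrite lee_fin (le_trans (enorm_row_mx _ _))// mulrDl lerD.
have w0 : 0 <= (b + b) * D k by rewrite mulr_ge0// addr_ge0.
have := @desingularizing_decrease _ nu xi t (E k.+1 - e) (E k.+2 - e) _ dxi
   _ _ _ w0 KLr.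
rewrite subr_ge0 eE lerD2r Enoninc// subr_gt0 eEk/=.
rewrite /t lerD2r vallo => /(_ isT isT).
case/andP: (tnu) => _ -> /(_ isT) gap.
rewrite /psi -mulrBr.
set q := xi _ - xi _ in gap *.
(* The inequality just obtained excludes a zero step, so that q, which is
   multiplied by D k in gap, is nonnegative. *)
have bD : 0 < b * D k by move: KLr; nra.
have q0 : 0 <= q.
  have : 0 <= E k.+1 - E k.+2 by rewrite subr_ge0 Enoninc.
  nra.
have := dec k.+1 => dk.
have sq : D k.+1 ^+ 2 <= D k * (2 * (b / a * q)).
  rewrite -(ler_pM2l a0) (le_trans dk)//.
  have -> : a * (D k * (2 * (b / a * q))) = (b + b) * D k * q.
    by field; rewrite gt_eqF.
  lra.
have rhs0 : 0 <= D k / 2 + b / a * q.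
  by rewrite addr_ge0 ?mulr_ge0 ?invr_ge0// ltW.
rewrite -ler_sqr ?nnegrE//.
apply: le_trans sq _; rewrite sqrrD.
have := sqr_ge0 (D k / 2 - b / a * q); rewrite sqrrB; lra.
Unshelve. all: by end_near.
Qed.

(** * One iteration of the line-search method *)

(** [Hmodel] with real parts in place of the extended values, so that the
    estimates below are real arithmetic. *)
Definition model (R : realType) n (f0 : 'rV[R]_n -> R) (f1 : 'rV[R]_n -> \bar R)
    (alpha : R) (x y : 'rV[R]_n) : R :=
  dotv (grad f0 x) (y - x) + enorm (y - x) ^+ 2 / (2 * alpha)
    + fine (f1 y) - fine (f1 x).

Lemma HmodelE (R : realType) n (f0 : 'rV[R]_n -> R) f1 alpha (x y : 'rV[R]_n) :
  eproper f1 -> edom f1 x -> edom f1 y ->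
  Hmodel f0 f1 alpha x y = (model f0 f1 alpha x y)%:E.
Proof.
move=> fp fx fy.
by rewrite /Hmodel (edom_fineK fp fx) (edom_fineK fp fy).
Qed.

Lemma DeltaE (R : realType) n (f0 : 'rV[R]_n -> R) f1 alpha U (x y : 'rV[R]_n) :
  eproper f1 -> edom f1 y ->
  Delta f0 f1 alpha U x y =
    (model f0 f1 alpha x y + fine (f1 x) - U)%:E.
Proof.
by move=> fp fy; rewrite /Delta (edom_fineK fp fy) /model subrK.
Qed.

Lemma objE (R : realType) n (f0 : 'rV[R]_n -> R) f1 (y : 'rV[R]_n) :
  eproper f1 -> edom f1 y -> obj f0 f1 y = (f0 y + fine (f1 y))%:E.
Proof. by move=> fp fy; rewrite /obj (edom_fineK fp fy) EFinD. Qed.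

Lemma Phi_trialE (R : realType) n (f0 : 'rV[R]_n -> R) f1 (x y : 'rV[R]_n) U t :
  eproper f1 -> edom f1 y ->
  Phi_trial f0 f1 x y U t =
    (f0 (x + t *: (y - x)) + (t * fine (f1 y) + (1 - t) * U))%:E.
Proof.
by move=> fp fy; rewrite /Phi_trial /Phi (edom_fineK fp fy) -EFinM -!EFinD.
Qed.

Lemma linesearchE (R : realType) n (f0 : 'rV[R]_n -> R) f1 omega alpha
    (x y : 'rV[R]_n) U t :
  eproper f1 -> edom f1 y ->
  linesearch f0 f1 omega alpha x y U t <->
  Num.min (f0 (x + t *: (y - x)) + (t * fine (f1 y) + (1 - t) * U))
          (f0 y + fine (f1 y))
    <= f0 x + U + omega * t * (model f0 f1 alpha x y + fine (f1 x) - U).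
Proof.
move=> fp fy; rewrite /linesearch Phi_trialE// objE// DeltaE// /Phi.
by rewrite -EFin_min -EFinM -!EFinD lee_fin.
Qed.

(** The model is the proximal objective up to a constant, hence strongly convex
    with modulus 1 / alpha and minimal at p; expanding the squares around p
    reduces the claim to [prox_subgradient]. *)
Lemma model_prox_growth (R : realType) n (f0 : 'rV[R]_n -> R) f1 alpha
    (x p y : 'rV[R]_n) :
    eproper f1 -> econvex f1 -> 0 < alpha ->
    prox alpha f1 (x - alpha *: grad f0 x) p -> edom f1 y ->
  model f0 f1 alpha x p + enorm (y - p) ^+ 2 / (2 * alpha)
    <= model f0 f1 alpha x y.
Proof.
move=> fp fc a0 pp fy; have := prox_subgradient fp fc a0 pp fy.
have -> : alpha^-1 *: (x - alpha *: grad f0 x - p) =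
    alpha^-1 *: (x - p) - grad f0 x.
  by rewrite addrAC scalerBr scalerA mulVf ?gt_eqF// scale1r.
rewrite dotvBl dotvZl /model.
have -> : enorm (y - x) ^+ 2 = enorm (y - p) ^+ 2 -
    2 * dotv (x - p) (y - p) + enorm (p - x) ^+ 2.
  have -> : y - x = (y - p) - (x - p) by rewrite opprB addrA subrK.
  by rewrite enormB_sqr (dotvC (y - p)) (enorm_distC p x).
have -> : dotv (grad f0 x) (y - x) =
    dotv (grad f0 x) (y - p) + dotv (grad f0 x) (p - x).
  by rewrite -dotvDr addrA subrK.
set s := dotv (x - p) _ => le.
have -> : (enorm (y - p) ^+ 2 - 2 * s + enorm (p - x) ^+ 2) / (2 * alpha) =
   enorm (y - p) ^+ 2 / (2 * alpha) - alpha^-1 * s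
     + enorm (p - x) ^+ 2 / (2 * alpha).
  by field; rewrite gt_eqF.
lra.
Qed.

Lemma model_self (R : realType) n (f0 : 'rV[R]_n -> R) f1 alpha (x : 'rV[R]_n) :
  model f0 f1 alpha x x = 0.
Proof.
by rewrite /model subrr dotvC dotv0l enorm_sqr dotv0l mul0r !add0r subrr.
Qed.

(** P is the predicted decrease. The growth of the model around its minimizer,
    applied at the inexact point and at x, bounds the distances to the minimizer
    by differences of model values, which the inexactness criterion compares
    with P. *)
Lemma inexact_prox_bounds (R : realType) n (f0 : 'rV[R]_n -> R) f1
    (alpha amax mu P : R) (x yt yh : 'rV[R]_n) :
    eproper f1 -> econvex f1 -> 0 < alpha <= amax -> 0 < mu ->
    edom f1 x -> edom f1 yt ->
    prox alpha f1 (x - alpha *: grad f0 x) yh ->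
    - P <= model f0 f1 alpha x yt ->
    model f0 f1 alpha x yt - model f0 f1 alpha x yh <= mu / 2 * P ->
  let C := amax * (2 + mu) in
  [/\ 0 <= P, enorm (yh - x) <= Num.sqrt (C * P) &
      enorm (yt - x) <= 2 * Num.sqrt (C * P)].
Proof.
move=> fp fc /andP[a0 aa] mu0 fx fyt pyh mP inex C.
have gt := model_prox_growth fp fc a0 pyh fyt.
have gx := model_prox_growth fp fc a0 pyh fx.
rewrite model_self in gx.
have sq_ge0 (u : 'rV[R]_n) : 0 <= enorm u ^+ 2 / (2 * alpha).
  by rewrite divr_ge0 ?exprn_ge0// mulr_ge0// ltW.
have P0 : 0 <= P.
  by rewrite -(pmulr_rge0 _ (divr_gt0 mu0 (ltr0n _ 2))); have := sq_ge0 (yt - yh); lra.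
have le_sqrt u : enorm u ^+ 2 / (2 * alpha) <= (1 + mu / 2) * P ->
    enorm u <= Num.sqrt (C * P).
  rewrite ler_pdivrMr ?mulr_gt0// => le.
  rewrite -[leLHS]ger0_norm// -sqrtr_sqr ler_wsqrtr// (le_trans le)//.
  have -> : (1 + mu / 2) * P * (2 * alpha) = alpha * ((2 + mu) * P) by field.
  by rewrite /C -mulrA ler_wpM2r// mulr_ge0// addr_ge0// ltW.
have bt : enorm (yt - yh) <= Num.sqrt (C * P) by apply: le_sqrt; lra.
have bh : enorm (yh - x) <= Num.sqrt (C * P).
  by rewrite enorm_distC; apply: le_sqrt; lra.
split=> //; rewrite -(subrK yh yt) -addrA (le_trans (enormD _ _))//; lra.
Qed.

(** The model without its quadratic term predicts the variation of the objective
    up to the linearization error of the smooth part. *)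
Lemma obj_model_error (R : realType) n (f0 : 'rV[R]_n -> R) f1 (L alpha : R)
    (x y : 'rV[R]_n) :
    eproper f1 -> econvex f1 -> 0 <= L -> elipschitz_on L (edom f1) (grad f0) ->
    (forall z, edom f1 z -> differentiable f0 z) ->
    edom f1 x -> edom f1 y ->
  `|(f0 y + fine (f1 y)) - (f0 x + fine (f1 x))
    - (model f0 f1 alpha x y - enorm (y - x) ^+ 2 / (2 * alpha))|
    <= L * enorm (y - x) ^+ 2.
Proof.
move=> fp fc L0 lip fd fx fy.
have := linearization_error L0 lip
  (fun t t01 => proj1 (econvex_segment fp fc fx fy t01)) fd.
by congr (`|_| <= _); rewrite /model; ring.
Qed.

(** The quadratic term of the model contributes -t |d|^2 / (2 alpha) to the
    predicted change, which for small t absorbs the linearization error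
    L t^2 |d|^2; the remaining part of the trial value is affine in t. *)
Lemma linesearch_small_step (R : realType) n (f0 : 'rV[R]_n -> R) f1
    (L omega alpha U t : R) (x y : 'rV[R]_n) :
    eproper f1 -> econvex f1 -> 0 <= L -> elipschitz_on L (edom f1) (grad f0) ->
    (forall z, edom f1 z -> differentiable f0 z) ->
    edom f1 x -> edom f1 y -> omega <= 1 -> 0 < alpha ->
    model f0 f1 alpha x y + fine (f1 x) - U <= 0 ->
    0 <= t <= 1 -> 2 * L * alpha * t <= 1 ->
  linesearch f0 f1 omega alpha x y U t.
Proof.
move=> fp fc L0 lip fd fx fy o1 a0 del0 t01 tsmall.
(* The first of the two trial values already satisfies the test. *)
apply/linesearchE => //; rewrite ge_min; apply/orP; left.
set d := y - x; have [t0 t1] := andP t01.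
have := @linearization_error _ _ f0 (edom f1) L x (x + t *: d) L0 lip.
rewrite [x + t *: d - x]addrC addKr => lin.
have {}lin : `|f0 (x + t *: d) - f0 x - dotv (grad f0 x) (t *: d)|
    <= L * enorm (t *: d) ^+ 2.
  apply: lin => // s /andP[s0 s1]; rewrite scalerA.
  apply: (proj1 (econvex_segment fp fc fx fy _)).
  by rewrite mulr_ge0//= mulr_ile1.
move: lin; rewrite ler_norml => /andP[_].
rewrite dotvZr enormZ exprMn real_normK ?num_real// => lin.
have quad : L * (t ^+ 2 * enorm d ^+ 2) <= t * (enorm d ^+ 2 / (2 * alpha)).
  have -> : t * (enorm d ^+ 2 / (2 * alpha)) = (t * enorm d ^+ 2) / (2 * alpha).
    by rewrite mulrA.
  rewrite ler_pdivlMr ?mulr_gt0//.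
  have -> : L * (t ^+ 2 * enorm d ^+ 2) * (2 * alpha) =
    (t * enorm d ^+ 2) * (2 * L * alpha * t) by ring.
  by rewrite ler_piMr// mulr_ge0// exprn_ge0.
have slack : t * (model f0 f1 alpha x y + fine (f1 x) - U) <=
    omega * t * (model f0 f1 alpha x y + fine (f1 x) - U).
  by rewrite ler_wnM2r// ler_piMl.
apply: le_trans (lerD (lexx _) slack); rewrite /model -/d; lra.
Qed.

(** Lower semicontinuity bounds the value at the limit from above. For the other
    direction, y k minimizes the model, so its model value is at most that of
    l, and the two models differ by terms that vanish with x k - l and
    y k - l; the gradients at x k stay bounded by the Lipschitz condition, once
    l is known to lie in the domain. *)
Lemma prox_gradient_closed (R : realType) n (f0 : 'rV[R]_n -> R) f1 (L amin : R)
    (x y : nat -> 'rV[R]_n) (alpha : nat -> R) (l : 'rV[R]_n) (e : R) :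
    eproper f1 -> lower_semicontinuous f1 -> econvex f1 -> 0 < amin ->
    0 <= L -> elipschitz_on L (edom f1) (grad f0) ->
    {for l, continuous f0} ->
    (forall k, edom f1 (x k)) -> (forall k, amin <= alpha k) ->
    (forall k, prox (alpha k) f1 (x k - alpha k *: grad f0 (x k)) (y k)) ->
    x @ \oo --> l -> y @ \oo --> l -> fine (obj f0 f1 (y k)) @[k --> \oo] --> e ->
  obj f0 f1 l = e%:E.
Proof.
move=> fp flsc fc amin0 L0 lip f0c fx aalpha py xl yl Fe.
have a0 k : 0 < alpha k := lt_le_trans amin0 (aalpha k).
have fy k : edom f1 (y k) := prox_edom fp (py k).
have f1y : fine (f1 (y k)) @[k --> \oo] --> e - f0 l.
  have -> : (fun k => fine (f1 (y k))) =
      (fun k => fine (obj f0 f1 (y k)) - f0 (y k)).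
    by apply/funext => k; rewrite objE//= addrC addKr.
  by apply: cvgB => //; apply: (cvg_comp _ _ yl f0c).
have f1l : (f1 l <= (e - f0 l)%:E)%E.
  apply/lee_addgt0Pr => d d0; rewrite leNgt; apply/negP => /flsc[V Vl VP].
  have near_gt : \forall k \near \oo, V (y k) := yl _ Vl.
  have near_lt : \forall k \near \oo, fine (f1 (y k)) < e - f0 l + d.
    by apply: (cvgr_lt _ f1y); rewrite ltrDl.
  have [k [/VP]] := filter_ex (filterI near_gt near_lt).
  by rewrite (edom_fineK fp (fy k)) lte_fin => /lt_trans/[apply]; rewrite ltxx.
have [fl f1l'] := edom_le fp f1l.
rewrite objE//; congr (_%:E); suff : e - f0 l <= fine (f1 l) by lra.
pose u k := fine (f1 (y k)) - ((enorm (grad f0 l) + L * enorm (x k - l)) *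
  enorm (y k - l) + enorm (x k - l) ^+ 2 / (2 * amin)).
have ulim : u @ \oo --> e - f0 l.
  have xl0 := enorm_cvg0 xl; have yl0 := enorm_cvg0 yl.
  rewrite -[X in _ --> X]subr0; apply: cvgB => //.
  rewrite -[X in _ --> X](addr0 0); apply: cvgD.
    rewrite -[X in _ --> X](mulr0 (enorm (grad f0 l) + L * 0)); apply: cvgM => //.
    by apply: cvgD; [exact: cvg_cst|apply: cvgMr].
  rewrite -[X in _ --> X](mul0r (2 * amin)^-1); apply: cvgMl.
  rewrite -[X in _ --> X](mulr0 (0 : R)); under eq_fun do rewrite expr2.
  exact: cvgM.
apply: (cvgr_to_le ulim); apply: nearW => k.
have := model_prox_growth fp fc (a0 k) (py k) fl.
have sq_ge0 (w : 'rV[R]_n) : 0 <= enorm w ^+ 2 / (2 * alpha k).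
  by rewrite divr_ge0 ?exprn_ge0// mulr_ge0// ltW.
have := sq_ge0 (l - y k); have := sq_ge0 (y k - x k); rewrite /model /u.
have : enorm (l - x k) ^+ 2 / (2 * alpha k) <= enorm (x k - l) ^+ 2 / (2 * amin).
  rewrite enorm_distC ler_wpM2l ?exprn_ge0// lef_pV2 ?posrE ?mulr_gt0//.
  by rewrite ler_wpM2l.
have : dotv (grad f0 (x k)) (l - x k) - dotv (grad f0 (x k)) (y k - x k) <=
   (enorm (grad f0 l) + L * enorm (x k - l)) * enorm (y k - l).
  rewrite -dotvBr opprB addrA subrK (le_trans (ler_norm _))//.
  rewrite (le_trans (cauchy_schwarz _ _))// (enorm_distC l) ler_wpM2r//.
  rewrite -(subrK (grad f0 l) (grad f0 (x k))) addrC (le_trans (enormD _ _))//.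
  by rewrite lerD2l lip.
lra.
Qed.

(** The last rejected step exceeds T, and one more reduction costs a factor
    delta. *)
Lemma backtracking_lower_bound (R : realType) (P : R -> Prop) (delta T : R)
    (m : nat) :
  0 < delta < 1 -> 0 < T -> (forall t, 0 < t <= 1 -> t <= T -> P t) ->
  (forall j, (j < m)%N -> ~ P (delta ^+ j)) ->
  Num.min 1 (delta * T) <= delta ^+ m.
Proof.
move=> /andP[d0 d1] T0 PT; case: m => [|m] smallest; rewrite ge_min.
  by rewrite expr0 lexx.
apply/orP; right; rewrite exprS ler_pM2l// leNgt; apply/negP => dT.
apply: (smallest m (leqnn _)); apply: PT; last exact: ltW.
by rewrite exprn_gt0//= exprn_ile1// ltW.
Qed.

(** * Convergence to a stationary point *)

Theorem theorem2 (R : realType) (n : nat)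
  (f0 : 'rV[R]_n -> R) (f1 : 'rV[R]_n -> \bar R)
  (Omega0 : set 'rV[R]_n) (L : R)
  (A1_proper : eproper f1)
  (A1_lsc : lower_semicontinuous f1)
  (A1_convex : econvex f1)
  (A2_open : open Omega0)
  (A2_dom : closure (edom f1) `<=` Omega0)
  (A2_C1 : C1_on f0 Omega0)
  (A3 : elipschitz_on L (edom f1) (grad f0))
  (A4 : exists c : R, forall z, (c%:E <= obj f0 f1 z)%E)
  (A5 : KL_function (lifted (obj f0 f1)))
  (alpha_min alpha_max delta omega : R)
  (alpha_min_gt0 : 0 < alpha_min)
  (alpha_min_le_max : alpha_min <= alpha_max)
  (delta01 : 0 < delta < 1)
  (omega01 : 0 < omega < 1)
  (x ytilde yhat : nat -> 'rV[R]_n) (U alpha eta : nat -> R) (m : nat -> nat)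
  (x0_dom : edom f1 (x 0%N))
  (eta01 : forall k, 0 < eta k <= 1)
  (x_step : forall k, x k.+1 = x k + eta k *: (ytilde k - x k))
  (S1_0 : (U 0%N)%:E = f1 (x 0%N))
  (S1_step : forall k,
    (U k.+1)%:E = ((eta k)%:E * f1 (ytilde k) + ((1 - eta k) * U k)%:E)%E)
  (S2_alpha : forall k, alpha_min <= alpha k <= alpha_max)
  (S2_prox : forall k,
    prox (alpha k) f1 (x k - alpha k *: grad f0 (x k)) (yhat k))
  (S2_inexact : exists2 mu : R, 0 < mu & forall k,
    (Hmodel f0 f1 (alpha k) (x k) (ytilde k)
       - Hmodel f0 f1 (alpha k) (x k) (yhat k)
     <= (- (mu / 2))%:E
          * Delta f0 f1 (alpha k) (U k) (x k) (ytilde k))%E)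
  (S3_holds : forall k,
    linesearch f0 f1 omega (alpha k) (x k) (ytilde k) (U k) (delta ^+ m k))
  (S3_smallest : forall k j, (j < m k)%N ->
    ~ linesearch f0 f1 omega (alpha k) (x k) (ytilde k) (U k) (delta ^+ j))
  (S3_eta : forall k,
    eta k = if (Phi_trial f0 f1 (x k) (ytilde k) (U k) (delta ^+ m k)
                  < obj f0 f1 (ytilde k))%E
            then delta ^+ m k else 1)
  (x_bounded : bounded_set (range x)) :
  exists xs : 'rV[R]_n,
    [/\ x k @[k --> \oo] --> xs,
        edom (obj f0 f1) xs &
        limiting_subdiff (obj f0 f1) xs 0].
Proof.
have a0 k : 0 < alpha k by have /andP[+ _] := S2_alpha k; apply: lt_le_trans.
have amax0 : 0 < alpha_max := lt_le_trans alpha_min_gt0 alpha_min_le_max.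
case: S2_inexact => mu mu0 inexact; have [Emin F_ge] := A4.
have [omega0 omega1] := andP omega01.
pose phi y := fine (f1 y); pose K := `|L| + 1.
have K0 : 0 < K by rewrite ltr_wpDl.
have lip : elipschitz_on K (edom f1) (grad f0).
  move=> y z fy fz; apply: le_trans (A3 y z fy fz) _.
  by rewrite ler_wpM2r// (le_trans (ler_norm _))// lerDl.
have fd z : edom f1 z -> differentiable f0 z.
  by move=> /subset_closure/A2_dom/A2_C1[].
have fyt k : edom f1 (ytilde k).
  rewrite /edom/= ltNge leye_eq; apply/negP => /eqP fy.
  have [eta0 _] := andP (eta01 k).
  by have := S1_step k; rewrite fy gt0_muley ?lte_fin.
have U_step k : U k.+1 = eta k * phi (ytilde k) + (1 - eta k) * U k.
  have := S1_step k; rewrite (edom_fineK A1_proper (fyt k)) -EFinM -EFinD.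
  by move=> [].
(* U majorizes the nonsmooth term because both are averaged with the same
   weights and f1 is convex. *)
have fx_le k : edom f1 (x k) /\ phi (x k) <= U k.
  elim: k => [|k [fxk IH]].
    by split => //; rewrite -lee_fin /phi -(edom_fineK A1_proper x0_dom) S1_0.
  have [eta0 eta1] := andP (eta01 k).
  have [] := econvex_segment (t := eta k) A1_proper A1_convex fxk (fyt k).
    by rewrite eta1 ltW.
  rewrite -x_step => fxS le; split => //; rewrite U_step /phi (le_trans le)//.
  by rewrite addrC lerD2l ler_wpM2l// subr_ge0.
have fx k := proj1 (fx_le k); have phiU k := proj2 (fx_le k).
have fyh k : edom f1 (yhat k) := prox_edom A1_proper (S2_prox k).
pose h k := model f0 f1 (alpha k) (x k).
(* The opposite of [Delta] at iteration k, as a real number. *)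
pose P k := U k - phi (x k) - h k (ytilde k).
have PE k : h k (ytilde k) + fine (f1 (x k)) - U k = - P k by rewrite /P /phi; ring.
pose C := alpha_max * (2 + mu).
have bounds k : [/\ 0 <= P k, enorm (yhat k - x k) <= Num.sqrt (C * P k) &
    enorm (ytilde k - x k) <= 2 * Num.sqrt (C * P k)].
  apply: (@inexact_prox_bounds _ _ f0 f1 (alpha k)) => //.
  - by have /andP[_ ->] := S2_alpha k; rewrite a0.
  - by rewrite /P -/(h k); have := phiU k; lra.
  - have := inexact k; rewrite !HmodelE// DeltaE// -/(h k) PE.
    by rewrite -EFinB -EFinM lee_fin mulrNN.
have C0 : 0 <= C by rewrite mulr_ge0 ?addr_ge0// ltW.
pose D k := Num.sqrt (P k).
have P0 k : 0 <= P k by have [] := bounds k.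
have D2 k : D k ^+ 2 = P k by rewrite sqr_sqrtr.
have sqrtCP k : Num.sqrt (C * P k) = Num.sqrt C * D k by rewrite sqrtrM.
pose c := 2 * Num.sqrt C.
have c0 : 0 <= c by rewrite mulr_ge0// sqrtr_ge0.
have cD k : Num.sqrt (C * P k) <= c * D k.
  by rewrite sqrtCP /c -mulrA ler_peMl ?mulr_ge0 ?sqrtr_ge0// ler1n.
have yhx k : enorm (yhat k - x k) <= c * D k.
  by have [_ + _] := bounds k; move=> /le_trans; apply.
have ytx k : enorm (ytilde k - x k) <= c * D k.
  by have [_ _] := bounds k; rewrite sqrtCP mulrA.
have sqrC2 k : (c * D k) ^+ 2 = 4 * C * P k.
  by rewrite exprMn D2 /c exprMn sqr_sqrtr//; ring.
have yhx2 k : enorm (yhat k - x k) ^+ 2 <= 4 * C * P k.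
  by rewrite -sqrC2 lerXn2r ?nnegrE ?mulr_ge0 ?sqrtr_ge0.
have ytx2 k : enorm (ytilde k - x k) ^+ 2 <= 4 * C * P k.
  by rewrite -sqrC2 lerXn2r ?nnegrE ?mulr_ge0 ?sqrtr_ge0.
pose F y := f0 y + phi y; pose E k := f0 (x k) + U k.
have accept k t : 0 < t <= 1 -> t <= (2 * K * alpha_max)^-1 ->
    linesearch f0 f1 omega (alpha k) (x k) (ytilde k) (U k) t.
  move=> t01 tT.
  have [t0 t1] := andP t01.
  apply: linesearch_small_step lip fd (fx k) (fyt k) _ (a0 k) _ _ _ => //.
  - exact: ltW.
  - exact: ltW.
  - by rewrite -/(h k) PE oppr_le0.
  - by rewrite t1 ltW.
  - have /andP[_ aM] := S2_alpha k.
    apply: (@le_trans _ _ (2 * K * alpha_max * t)).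
      by rewrite ler_wpM2r ?(ltW t0)// ler_wpM2l// mulr_ge0// ltW.
    by rewrite mulrC -ler_pdivlMr ?div1r// !mulr_gt0.
have tau_le k : Num.min 1 (delta * (2 * K * alpha_max)^-1) <= delta ^+ m k.
  apply: (@backtracking_lower_bound _
    (linesearch f0 f1 omega (alpha k) (x k) (ytilde k) (U k))) => //.
  - by rewrite invr_gt0 !mulr_gt0.
  - exact: accept.
  - by move=> j; apply: S3_smallest.
set tau := Num.min 1 _ in tau_le.
have tau0 : 0 < tau.
  have /andP[d0 _] := delta01.
  by rewrite lt_min ltr01 mulr_gt0// invr_gt0 !mulr_gt0.
(* The choice of eta makes E (k + 1) the smaller of the two trial values, so
   that it is at most F (ytilde k) and satisfies the line-search test. *)
have step k : E k.+1 <= F (ytilde k) /\ E k.+1 <= E k - omega * delta ^+ m k * P k.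
  have /linesearchE := S3_holds k; rewrite -/(h k) PE => /(_ A1_proper (fyt k)).
  have := S3_eta k; rewrite Phi_trialE// objE// lte_fin mulrN.
  rewrite -/(phi (ytilde k)) -/(F (ytilde k)).
  have ES : E k.+1 = f0 (x k + eta k *: (ytilde k - x k)) +
    (eta k * phi (ytilde k) + (1 - eta k) * U k) by rewrite /E x_step U_step.
  case: ltP => [lt_trial|le_trial] etaE.
    rewrite -etaE in lt_trial *.
    by rewrite -ES => ls; split => //; rewrite ES ltW.
  by rewrite ES etaE scale1r subrKC mul1r subrr mul0r addr0.
have dec k : omega * tau * D k ^+ 2 <= E k - E k.+1.
  have [_ le] := step k; rewrite D2.
  have : omega * tau * P k <= omega * delta ^+ m k * P k.
    by rewrite ler_wpM2r// ler_wpM2l// ltW.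
  by move: le; lra.
have E_ge k : Emin <= E k.
  have := F_ge (x k); rewrite objE// lee_fin => /le_trans; apply.
  by rewrite /E lerD2l; exact: phiU.
have err k y : edom f1 y -> `|F y - F (x k) - (h k y - enorm (y - x k) ^+ 2 /
    (2 * alpha k))| <= K * enorm (y - x k) ^+ 2.
  by move=> fy; apply: obj_model_error => //; exact: ltW.
pose B := 2 * C / alpha_min.
have prox_term k y : enorm (y - x k) ^+ 2 <= 4 * C * P k ->
    0 <= enorm (y - x k) ^+ 2 / (2 * alpha k) <= B * P k.
  move=> le; apply/andP; split.
    by rewrite divr_ge0 ?exprn_ge0// mulr_ge0// ltW.
  have -> : B * P k = 4 * C * P k / (2 * alpha_min).
    by rewrite /B; field; rewrite gt_eqF.
  apply: ler_pM => //; first by rewrite exprn_ge0.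
    by rewrite invr_ge0 mulr_ge0// ltW.
  rewrite lef_pV2 ?posrE ?mulr_gt0// ler_wpM2l//.
  by have /andP[] := S2_alpha k.
have B0 : 0 <= B by rewrite divr_ge0 ?(mulr_ge0 _ C0)// ltW.
pose C1 := 4 * K * C; have C10 : 0 <= C1 by rewrite (mulr_ge0 _ C0)// mulr_ge0// ltW.
pose C2 := mu / 2 + B + 2 * C1.
have C20 : 0 <= C2.
  by rewrite (addr_ge0 (addr_ge0 _ B0) (mulr_ge0 _ C10))// divr_ge0// ltW.
have quad k y : enorm (y - x k) ^+ 2 <= 4 * C * P k ->
    K * enorm (y - x k) ^+ 2 <= C1 * P k.
  move=> /(ler_wpM2l (ltW K0)); rewrite /C1; lra.
(* With the next bound, this sandwiches F (yhat k) between E (k + 1) and E k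
   up to multiples of P k; rho k is chosen to compensate the lower defect. *)
have yt_yh k : F (ytilde k) <= F (yhat k) + C2 * P k.
  have := err k _ (fyt k); have := err k _ (fyh k); rewrite !ler_norml.
  have := quad k _ (yhx2 k); have := quad k _ (ytx2 k).
  have /andP[] := prox_term k _ (yhx2 k); have /andP[] := prox_term k _ (ytx2 k).
  have : h k (ytilde k) - h k (yhat k) <= mu / 2 * P k.
    have := inexact k; rewrite !HmodelE// DeltaE// -/(h k) PE.
    by rewrite -EFinB -EFinM lee_fin mulrNN.
  move=> ? ? ? ? ? ? ? /andP[? ?] /andP[? ?]; rewrite /C2; lra.
have yh_E k : F (yhat k) <= E k + C1 * P k.
  have := err k _ (fyh k); rewrite !ler_norml; have := quad k _ (yhx2 k).
  have /andP[] := prox_term k _ (yhx2 k).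
  have := model_prox_growth A1_proper A1_convex (a0 k) (S2_prox k) (fx k).
  rewrite model_self -/(h k).
  have : 0 <= enorm (x k - yhat k) ^+ 2 / (2 * alpha k).
    by rewrite divr_ge0 ?exprn_ge0// mulr_ge0// ltW.
  have := phiU k; rewrite /E /F => ? ? ? ? ? ? /andP[? ?]; lra.
(* The proximal optimality condition provides the second summand, a
   subgradient of f1 at yhat k. *)
pose v k := grad f0 (yhat k) +
  (alpha k)^-1 *: (x k - alpha k *: grad f0 (x k) - yhat k).
pose rho k := Num.sqrt (2 * C2) * D k.
have rho2 k : rho k ^+ 2 / 2 = C2 * P k.
  by rewrite exprMn sqr_sqrtr ?mulr_ge0// D2; field.
pose bv := (K + alpha_min^-1) * c.
have bv0 : 0 <= bv by rewrite mulr_ge0// addr_ge0 ?invr_ge0// ltW.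
have v_le k : enorm (v k) <= bv * D k.
  have -> : v k = (grad f0 (yhat k) - grad f0 (x k)) - (alpha k)^-1 *: (yhat k - x k).
    rewrite /v addrAC !scalerBr scalerA mulVf ?gt_eqF// scale1r.
    by rewrite opprB addrA addrAC.
  apply: le_trans (enormB _ _) _; rewrite enormZ gtr0_norm ?invr_gt0//.
  rewrite /bv -mulrA mulrDl lerD//.
    by rewrite (le_trans (lip _ _ (fyh k) (fx k)))// ler_wpM2l// ltW.
  apply: ler_pM => //; first by rewrite invr_ge0 ltW.
  by rewrite lef_pV2 ?posrE//; have /andP[] := S2_alpha k.
pose b := Num.max bv (Num.max (Num.sqrt (2 * C2)) (C1 + C2)).
apply: (@kl_descent_convergence _ _ (obj f0 f1) x yhat v E rho D
          (omega * tau) b c Emin) => //.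
- by rewrite mulr_gt0.
- by rewrite le_max bv0.
- by move=> k; rewrite sqrtr_ge0.
- move=> k; rewrite x_step addrC addKr enormZ; have [e0 e1] := andP (eta01 k).
  by rewrite (le_trans _ (ytx k))// gtr0_norm// ler_piMl.
- move=> k; apply: obj_regular => //; first exact: fd.
  by move=> y fy; apply: (prox_subgradient A1_proper A1_convex (a0 k) (S2_prox k)).
- by move=> k; rewrite (le_trans (v_le k))// ler_wpM2r ?sqrtr_ge0// le_max lexx.
- move=> k; rewrite ger0_norm ?mulr_ge0 ?sqrtr_ge0// ler_wpM2r ?sqrtr_ge0//.
  by rewrite !le_max lexx orbT.
- move=> k; rewrite objE//= -/(phi _) -/(F (yhat k)) rho2 D2; apply/andP; split.
    exact: le_trans (proj1 (step k)) (yt_yh k).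
  have : (C1 + C2) * P k <= b * P k by rewrite ler_wpM2r// !le_max lexx !orbT.
  by have := yh_E k; lra.
move=> s l e xl yl Fl.
apply: (@prox_gradient_closed _ _ f0 f1 K alpha_min (x \o s) (yhat \o s)
  (alpha \o s)) => //.
- exact: ltW.
- have cl : closure (edom f1) l.
    move=> V /yl [N _ NV]; exists (yhat (s N)); split; first exact: fyh.
    exact: (NV N (leqnn N)).
  by have [/differentiable_continuous] := A2_C1 _ (A2_dom _ cl).
- by move=> j /=.
- by move=> j /=; have /andP[] := S2_alpha (s j).
- by move=> j /=.
Qed.
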